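(* Let $R=\mathbb{Z}\oplus\bigoplus_{i\ge 1}\mathbb{Z}/2\mathbb{Z}$ be the commutative ring with componentwise addition and multiplication $(m,a)\cdot(n,b)=(mn,\,mb+na+ab)$. Then $\mathcal{FP}_2\text{-}\mathrm{Inj}\subsetneq R\text{-}\mathrm{Mod}$ and $\mathcal{FP}_2\text{-}\mathrm{Flat}\subsetneq R\text{-}\mathrm{Mod}$; that is, not every $R$-module is $\mathrm{FP}_2$-injective and not every $R$-module is $\mathrm{FP}_2$-flat.
   Context: In the multiplication, $m,n\in\mathbb{Z}$, $a,b\in\bigoplus_{i\ge1}\mathbb{Z}/2\mathbb{Z}$, $ma=(ma_1,ma_2,\dots)$ and $ab=(a_1b_1,a_2b_2,\dots)$. $R\text{-}\mathrm{Mod}$ is the class of all $R$-modules. $\mathcal{FP}_2$ is the class of $R$-modules $F$ admitting an exact sequence $F_2\to F_1\to F_0\to F\to 0$ with each $F_i$ finitely generated and free (equivalently projective). $\mathcal{FP}_2\text{-}\mathrm{Inj}$ is the class of $R$-modules $M$ with $\mathrm{Ext}^1_R(F,M)=0$ for all $F\in\mathcal{FP}_2$, and $\mathcal{FP}_2\text{-}\mathrm{Flat}$ is the class of $R$-modules $M$ with $\mathrm{Tor}_1^R(F,M)=0$ for all $F\in\mathcal{FP}_2$. *)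

(* Defs.v *)
From HB Require Import structures.
From mathcomp Require Import all_boot all_order all_algebra.
From mathcomp Require Import finmap.
From mathcomp Require Import ring boolp functions.
From mathcomp.multinomials Require Import monalg.

Set Implicit Arguments.
Unset Strict Implicit.
Unset Printing Implicit Defensive.

Import GRing.Theory Num.Theory.
Local Open Scope fset_scope.
Local Open Scope ring_scope.
Local Open Scope quotient_scope.

Section Kernel.
Variables (R : pzRingType) (A B : lmodType R) (f : {linear A -> B}).

Definition in_ker : {pred A} := [pred x | f x == 0].

Lemma in_ker_submod : submod_closed in_ker.
Proof.
split=> [|a x y]; rewrite !inE ?linear0 //.
by move=> /eqP fx /eqP fy; rewrite linearP fx fy scaler0 addr0.
Qed.
HB.instance Definition _ :=
  GRing.isSubmodClosed.Build R A in_ker in_ker_submod.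

Record kernel := Kernel { kernel_val : A; kernelP : kernel_val \in in_ker }.

HB.instance Definition _ := [isSub for kernel_val].
HB.instance Definition _ := [Choice of kernel by <:].
HB.instance Definition _ := [SubChoice_isSubLmodule of kernel by <:].
End Kernel.

Section Homology.
Variables (A B C : zmodType) (f : {additive A -> B}) (g : {additive B -> C}).

Definition is_cycle : {pred B} := [pred y | g y == 0].

Lemma is_cycle_zmod : zmod_closed is_cycle.
Proof.
split=> [|x y]; rewrite !inE ?raddf0 //.
by move=> /eqP gx /eqP gy; rewrite raddfB gx gy subrr.
Qed.
HB.instance Definition _ := GRing.isZmodClosed.Build B is_cycle is_cycle_zmod.

Record cycles := Cycle { cycle_val : B; cycleP : cycle_val \in is_cycle }.

HB.instance Definition _ := [isSub for cycle_val].
HB.instance Definition _ := [Choice of cycles by <:].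
HB.instance Definition _ := [SubChoice_isSubZmodule of cycles by <:].

Definition is_boundary : {pred cycles} :=
  [pred y : cycles | `[< exists x, f x = val y >]].

Lemma is_boundary_zmod : zmod_closed is_boundary.
Proof.
split=> [|x y]; rewrite !inE.
  by apply/asboolP; exists 0; rewrite !raddf0.
move=> /asboolP[u fu] /asboolP[v fv]; apply/asboolP.
by exists (u - v); rewrite !raddfB fu fv.
Qed.
HB.instance Definition _ :=
  GRing.isZmodClosed.Build cycles is_boundary is_boundary_zmod.

(* ker g / im f; no condition g \o f = 0 is needed, as the subgroup divided   *)
(* out consists of the cycles that lie in the image of f.                     *)
Definition homology : zmodType := Quotient.quot is_boundary.
End Homology.

Definition exact_at (A B C : zmodType) (f : A -> B) (g : B -> C) : Prop :=
  forall y, g y = 0 <-> exists x, f x = y.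

Definition surj (A B : Type) (f : A -> B) : Prop := forall y, exists x, f x = y.

Definition is_zero_group (A : zmodType) : Prop := forall x : A, x = 0.

(* {malg R[X]} is the free R-module on the set X, with basis << x >>. *)
Section FreeLift.
Variables (R : nzRingType) (X : choiceType) (V : lmodType R) (h : X -> V).

Definition free_lift (u : {malg R[X]}) : V := \sum_(x <- msupp u) u@_x *: h x.

Lemma free_liftEw (D : {fset X}) u : msupp u `<=` D ->
  free_lift u = \sum_(x <- D) u@_x *: h x.
Proof.
move=> uD; apply: big_fset_incl => // x _ /mcoeff_outdom ->.
by rewrite scale0r.
Qed.

Lemma free_lift_linear : linear free_lift.
Proof.
move=> a u v; pose D := msupp (a *: u + v) `|` (msupp u `|` msupp v).
rewrite (@free_liftEw D) ?fsubsetUl// (@free_liftEw D u); last first.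
  by rewrite fsubsetU// fsubsetUl orbT.
rewrite (@free_liftEw D v); last by rewrite fsubsetU// fsubsetUr orbT.
rewrite scaler_sumr -big_split /=; apply: eq_bigr => x _.
by rewrite mcoeffD mcoeffZ scalerDl scalerA.
Qed.
HB.instance Definition _ :=
  GRing.isLinear.Build R {malg R[X]} V *:%R free_lift free_lift_linear.

Lemma free_liftU x : free_lift << x >> = h x.
Proof.
rewrite (@free_liftEw [fset x]) ?msuppU_le//.
by rewrite big_seq_fset1 mcoeffUU scale1r.
Qed.
End FreeLift.

(* Ext and Tor are computed from the canonical free resolution                *)
(*   ... -> R^(syzygy F 2) -> R^(syzygy F 1) -> R^(F) -> F -> 0,              *)
(* where syzygy F n.+1 is the kernel of R^(syzygy F n) -> syzygy F n; see     *)
(* cover_surj, res_exact0 and res_exactS for exactness.                       *)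
Section Resolution.
Variable R : nzRingType.

Definition cover (V : lmodType R) : {linear {malg R[V]} -> V} :=
  free_lift (@id V).

Fixpoint syzygy (F : lmodType R) (n : nat) : lmodType R :=
  if n is n'.+1 then kernel (cover (syzygy F n')) else F.

Definition res (F : lmodType R) (n : nat) : lmodType R :=
  {malg R[syzygy F n]}.

Definition res_diff_fun (F : lmodType R) (n : nat) (u : res F n.+1) : res F n :=
  val (cover (syzygy F n.+1) u).

Lemma res_diff_linear F n : linear (@res_diff_fun F n).
Proof. by move=> a u v; rewrite /res_diff_fun !linearP. Qed.
HB.instance Definition _ F n := GRing.isLinear.Build R (res F n.+1) (res F n)
  *:%R (@res_diff_fun F n) (@res_diff_linear F n).

Definition res_diff F n : {linear res F n.+1 -> res F n} := @res_diff_fun F n.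

Lemma cover_surj (V : lmodType R) : surj (cover V).
Proof. by move=> x; exists << x >>; rewrite /= free_liftU. Qed.

Lemma res_exact0 F : exact_at (res_diff F 0) (cover F).
Proof.
move=> y; split=> [/eqP y0|[u <-]]; last first.
  by apply/eqP; exact: (valP (cover (syzygy F 1) u)).
have [u ux] := @cover_surj (syzygy F 1) (@Kernel _ _ _ (cover F) y y0).
by exists u; rewrite /= /res_diff_fun ux.
Qed.

Lemma res_exactS F n : exact_at (res_diff F n.+1) (res_diff F n).
Proof.
move=> y; split=> [y0|[u <-]]; last first.
  have /eqP e := valP (cover (syzygy F n.+2) u).
  by rewrite /= /res_diff_fun [X in val X]e raddf0.
have {}y0 : cover (syzygy F n.+1) y == 0.
  by apply/eqP/val_inj; rewrite raddf0.
have [u ux] := @cover_surj (syzygy F n.+2)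
  (@Kernel _ _ _ (cover (syzygy F n.+1)) y y0).
by exists u; rewrite /= /res_diff_fun ux.
Qed.
End Resolution.

Section Hom.
Variables (R : comNzRingType) (V M : lmodType R).

Definition is_hom : {pred V -> M} := [pred h : V -> M | `[< linear h >]].

Lemma is_hom_zmod : zmod_closed is_hom.
Proof.
split=> [|h k]; rewrite !inE.
  by apply/asboolP => a x y; rewrite scaler0 addr0.
move=> /asboolP lh /asboolP lk; apply/asboolP => a x y.
by rewrite !fctE lh lk scalerBr opprD addrACA.
Qed.
HB.instance Definition _ := GRing.isZmodClosed.Build (V -> M) is_hom is_hom_zmod.

Record hom := Hom { hom_val :> V -> M; homP : hom_val \in is_hom }.

HB.instance Definition _ := [isSub for hom_val].
HB.instance Definition _ := [Choice of hom by <:].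
HB.instance Definition _ := [SubChoice_isSubZmodule of hom by <:].
End Hom.

Section HomMap.
Variables (R : comNzRingType) (V W M : lmodType R) (f : {linear V -> W}).

Lemma hom_comp_subproof (h : hom W M) : (h \o f) \in @is_hom R V M.
Proof.
rewrite inE; apply/asboolP => a x y /=; rewrite linearP.
by have := homP h; rewrite inE => /asboolP ->.
Qed.

Definition hom_map (h : hom W M) : hom V M := Hom (hom_comp_subproof h).

Lemma hom_map_zmod : zmod_morphism hom_map.
Proof. by move=> h k; apply: val_inj. Qed.
HB.instance Definition _ := GRing.isZmodMorphism.Build (hom W M) (hom V M)
  hom_map hom_map_zmod.
End HomMap.
Arguments hom_map {R V W} M f.

Definition Ext1 (R : comNzRingType) (F M : lmodType R) : zmodType :=
  homology (hom_map M (res_diff F 0)) (hom_map M (res_diff F 1)).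

Section Tensor.
Variables (R : comNzRingType) (V M : lmodType R).

Inductive bilinear_span : {malg int[(V * M)%type]} -> Prop :=
| span0 : bilinear_span 0
| spanB u v : bilinear_span u -> bilinear_span v -> bilinear_span (u - v)
| spanDl x y m :
    bilinear_span (<< (x + y, m) >> - << (x, m) >> - << (y, m) >>)
| spanDr x m n :
    bilinear_span (<< (x, m + n) >> - << (x, m) >> - << (x, n) >>)
| spanZ (r : R) x m :
    bilinear_span (<< (r *: x, m) >> - << (x, r *: m) >>).

Definition in_span : {pred {malg int[(V * M)%type]}} :=
  [pred u | `[< bilinear_span u >]].

Lemma in_span_zmod : zmod_closed in_span.
Proof.
split=> [|u v]; rewrite !inE; first by apply/asboolP; exact: span0.
by move=> /asboolP hu /asboolP hv; apply/asboolP; exact: spanB.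
Qed.
HB.instance Definition _ := GRing.isZmodClosed.Build _ in_span in_span_zmod.

(* V (x)_R M as an abelian group; bilinear_span is the subgroup of relations. *)
Definition tensor : zmodType := Quotient.quot in_span.
End Tensor.

Section TensorMap.
Variables (R : comNzRingType) (V W M : lmodType R) (f : {linear V -> W}).

Definition tensor_push :
    {linear {malg int[(V * M)%type]} -> {malg int[(W * M)%type]}} :=
  free_lift (fun p : V * M => << (f p.1, p.2) >> : {malg int[(W * M)%type]}).

Lemma tensor_push_span u :
  bilinear_span u -> bilinear_span (tensor_push u).
Proof.
elim=> [|{}u v _ hu _ hv|x y m|x m n|r x m]; rewrite ?raddf0 ?raddfB /=.
- exact: span0.
- exact: spanB.
- by rewrite !free_liftU /= linearD; exact: spanDl.
- by rewrite !free_liftU; exact: spanDr.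
- by rewrite !free_liftU /= linearZ; exact: spanZ.
Qed.

Definition tensor_map (t : tensor V M) : tensor W M :=
  \pi_(tensor W M) (tensor_push (repr t)).

Lemma tensor_map_pi u :
  tensor_map (\pi_(tensor V M) u) = \pi_(tensor W M) (tensor_push u).
Proof.
apply/eqP; rewrite /tensor_map -Quotient.idealrBE -raddfB inE.
apply/asboolP/tensor_push_span/asboolP.
suff: repr (\pi_(tensor V M) u) - u \in @in_span R V M by rewrite inE.
by rewrite Quotient.idealrBE reprK.
Qed.

Lemma tensor_map_zmod : zmod_morphism tensor_map.
Proof.
move=> s t; rewrite -[s]reprK -[t]reprK -raddfB !tensor_map_pi.
by rewrite !raddfB.
Qed.
HB.instance Definition _ := GRing.isZmodMorphism.Build (tensor V M) (tensor W M)
  tensor_map tensor_map_zmod.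
End TensorMap.
Arguments tensor_map {R V W} M f.

Definition Tor1 (R : comNzRingType) (F M : lmodType R) : zmodType :=
  homology (tensor_map M (res_diff F 1)) (tensor_map M (res_diff F 0)).

Definition mod_class (R : comNzRingType) := lmodType R -> Prop.

Definition proper_subclass (R : comNzRingType) (C D : mod_class R) : Prop :=
  (forall M, C M -> D M) /\ ~ (forall M, D M -> C M).

Section Classes.
Variable R : comNzRingType.

Definition all_modules : mod_class R := fun _ => True.

Definition fg_free : mod_class R := fun V =>
  exists (n : nat) (f : {linear 'rV[R]_n -> V}), bijective f.

Definition FP2 : mod_class R := fun F =>
  exists (F2 F1 F0 : lmodType R)
         (d2 : {linear F2 -> F1}) (d1 : {linear F1 -> F0})
         (d0 : {linear F0 -> F}),
    [/\ fg_free F2, fg_free F1 & fg_free F0] /\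
    [/\ exact_at d2 d1, exact_at d1 d0 & surj d0].

(* all_modules, FP2, FP2_Inj, FP2_Flat range over modules with carriers in a  *)
(* fixed universe; the carrier of an lmodType has a choice structure, which   *)
(* any type has classically.                                                  *)
Definition FP2_Inj : mod_class R := fun M =>
  forall F : lmodType R, FP2 F -> is_zero_group (Ext1 F M).

Definition FP2_Flat : mod_class R := fun M =>
  forall F : lmodType R, FP2 F -> is_zero_group (Tor1 F M).
End Classes.

(* Finitely supported functions nat -> Z/2; the index i : nat stands for the  *)
(* coordinate i + 1.  Only the additive structure of {malg _[_]} is used: its *)
(* library product, a convolution, is not the one wanted here.                *)
Definition sumZ2 : zmodType := {malg 'Z_2[nat]}.

(* The product ab; the product ma of m : int with a is a *~ m (sumZ2_mulz). *)
Definition sumZ2_mul (a b : sumZ2) : sumZ2 :=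
  [malg i in msupp a `|` msupp b => a@_i * b@_i].

Lemma sumZ2_mulE a b i : (sumZ2_mul a b)@_i = a@_i * b@_i.
Proof.
rewrite mcoeffE in_fsetE.
by case: (msuppP a i); case: (msuppP b i); rewrite ?mul0r ?mulr0.
Qed.

Definition ZsumZ2 : Type := (int * sumZ2)%type.
HB.instance Definition _ := GRing.Zmodule.on ZsumZ2.

Definition ZsumZ2_mul (x y : ZsumZ2) : ZsumZ2 :=
  let: (m, a) := x in let: (n, b) := y in
  (m * n, b *~ m + a *~ n + sumZ2_mul a b).

Definition ZsumZ2_one : ZsumZ2 := (1, 0).

Lemma sumZ2_eq (a b : sumZ2) : (forall i, a@_i = b@_i) -> a = b.
Proof. by move=> h; apply/malgP. Qed.

Lemma sumZ2_mulz (a : sumZ2) (m : int) i : (a *~ m)@_i = m%:~R * a@_i.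
Proof. by rewrite raddfMz mulrzl. Qed.

Definition sumZ2E :=
  (@mcoeffD nat 'Z_2, @mcoeff0 nat 'Z_2, sumZ2_mulz, sumZ2_mulE).

Lemma ZsumZ2_mulA : associative ZsumZ2_mul.
Proof.
move=> [m a] [n b] [p c]; congr pair; first exact: mulrA.
by apply: sumZ2_eq => i; rewrite !sumZ2E !rmorphM /=; ring.
Qed.

Lemma ZsumZ2_mulC : commutative ZsumZ2_mul.
Proof.
move=> [m a] [n b]; congr pair; first exact: mulrC.
by apply: sumZ2_eq => i; rewrite !sumZ2E; ring.
Qed.

Lemma ZsumZ2_mul1 : left_id ZsumZ2_one ZsumZ2_mul.
Proof.
move=> [m a]; congr pair; first exact: mul1r.
by apply: sumZ2_eq => i; rewrite !sumZ2E; ring.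
Qed.

Lemma ZsumZ2_mulDl : left_distributive ZsumZ2_mul +%R.
Proof.
move=> [m a] [n b] [p c]; congr pair; first exact: mulrDl.
by apply: sumZ2_eq => i; rewrite !sumZ2E !rmorphD /=; ring.
Qed.

Lemma ZsumZ2_one_neq0 : ZsumZ2_one != 0 :> ZsumZ2.
Proof. by []. Qed.

HB.instance Definition _ := GRing.Zmodule_isComNzRing.Build ZsumZ2
  ZsumZ2_mulA ZsumZ2_mulC ZsumZ2_mul1 ZsumZ2_mulDl ZsumZ2_one_neq0.

(* Main.v *)
(** The element 3 is a non-zero-divisor of [R], because it acts as the identity
on the summand of exponent 2, and [R / 3R = Z/3]. Hence [Z/3] lies in [FP_2],
by the resolution [0 -> R -> R -> Z/3 -> 0]. Dividing by 3 gives a linear map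
from the first syzygy of [Z/3] to [Z/3] with value 1 on [3 e_1]. It does not
extend to the free module, where [3 e_1] must go to 0, so [Ext^1(Z/3, Z/3)] is
nonzero; and the induced map on [syzygy (x) Z/3] detects the class of
[3 e_1 (x) 1], which dies in [R^(Z/3) (x) Z/3], so [Tor_1(Z/3, Z/3)] is
nonzero. *)
Require Import Defs.
From mathcomp Require Import all_boot all_algebra.
From HB Require Import structures.
From mathcomp Require Import boolp zify.
From mathcomp.multinomials Require Import monalg.

Set Implicit Arguments.
Unset Strict Implicit.
Unset Printing Implicit Defensive.

Import GRing.Theory.
Local Open Scope ring_scope.
Local Open Scope quotient_scope.

(* [cover] and [Hom] are shadowed by finset and vector. *)
Import Defs.

(** * Criteria for nonzero Ext and Tor *)

Lemma homology_neq0 (A B C : zmodType) (f : {additive A -> B})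
    (g : {additive B -> C}) (y : B) :
  g y = 0 -> (forall x, f x <> y) -> ~ is_zero_group (homology f g).
Proof.
move=> /eqP gy nfy H0; pose c := @Cycle _ _ g y gy.
have /eqP := H0 (\pi_(homology f g) c).
rewrite -(raddf0 \pi_(homology f g)) -Quotient.idealrBE subr0 inE.
by move=> /asboolP[x /nfy].
Qed.

Lemma cover_res_diff (R : nzRingType) (F : lmodType R) n (u : res F n.+2) :
  cover (syzygy F n.+1) (res_diff F n.+1 u) = 0.
Proof.
have d0 := (res_exactS (res_diff F n.+1 u)).2 (ex_intro _ u erefl).
by apply: val_inj; rewrite [LHS]d0.
Qed.

Lemma coverU (R : nzRingType) (V : lmodType R) (v : V) : cover V << v >> = v.
Proof. by rewrite /= free_liftU. Qed.

Lemma res_diffU (R : nzRingType) (F : lmodType R) n (z : syzygy F n.+1) :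
  res_diff F n << z >> = val z.
Proof. by rewrite /= /res_diff_fun coverU. Qed.

(** The cocycle is [h] composed with the cover of the first syzygy. A cochain [g] bounding it would
    give [h z = g (r *: << x >>) = r *: g << x >> = 0]. *)
Lemma Ext1_neq0 (R : comNzRingType) (F M : lmodType R) (r : R) (x : F)
    (z : kernel (cover F)) (h : {linear kernel (cover F) -> M}) :
    (forall m : M, r *: m = 0) -> val z = r *: << x >> -> h z <> 0 ->
  ~ is_zero_group (Ext1 F M).
Proof.
move=> rM zx hz; pose hc u := h (cover (syzygy F 1) u).
have hcP : hc \in @is_hom R (res F 1) M.
  by rewrite inE; apply/asboolP => a u v; rewrite /hc !linearP.
apply: (@homology_neq0 _ _ _ (hom_map M (res_diff F 0))
  (hom_map M (res_diff F 1)) (Hom hcP)).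
  apply: val_inj; apply: funext => u /=; rewrite /hc.
  by rewrite cover_res_diff linear0.
move=> g /(congr1 (fun k : hom _ _ => k << z >>)).
rewrite [LHS]/(g (res_diff F 0 << z >>)) [RHS]/(hc << z >>) /hc.
rewrite (coverU (V := syzygy F 1)) (res_diffU (n := 0)) zx.
have := homP g; rewrite inE => /asboolP lg.
have g0 : g 0 = 0.
  by have := lg (-1) 0 0; rewrite scaler0 addr0 scaleN1r addNr.
have := lg r << x >> 0; rewrite addr0 g0 addr0 rM => grx gz.
by apply: hz; rewrite -[LHS]gz [LHS]grx.
Qed.

Section TensorEval.
Variables (R : comNzRingType) (V M : lmodType R) (A : zmodType).
Variable b : V -> M -> A.
Hypothesis bDl : forall x y m, b (x + y) m = b x m + b y m.
Hypothesis bDr : forall x m n, b x (m + n) = b x m + b x n.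
Hypothesis bZ : forall r x m, b (r *: x) m = b x (r *: m).

(** [zmodule A] is [A] as a module over [int], so that [free_lift] applies. The map stays on the
    free group: its constancy on tensor classes, [tensor_eval_pi], is enough. *)
Definition tensor_eval : {linear {malg int[(V * M)%type]} -> zmodule A} :=
  free_lift (fun p : V * M => b p.1 p.2 : zmodule A).

Lemma tensor_evalU v m : tensor_eval << (v, m) >> = b v m.
Proof. by rewrite /= free_liftU. Qed.

Lemma tensor_eval_span u : bilinear_span u -> tensor_eval u = 0.
Proof.
elim=> [|{}u v _ hu _ hv|x y m|x m n|r x m]; rewrite ?raddf0 ?raddfB //=.
- by rewrite hu hv subrr.
- by rewrite !free_liftU /= bDl [b x m + _]addrC addrK subrr.
- by rewrite !free_liftU /= bDr [b x m + _]addrC addrK subrr.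
- by rewrite !free_liftU /= bZ subrr.
Qed.

Lemma tensor_eval_pi u v :
  \pi_(tensor V M) u = \pi_(tensor V M) v -> tensor_eval u = tensor_eval v.
Proof.
move=> /eqP; rewrite -Quotient.idealrBE inE => /asboolP/tensor_eval_span.
by rewrite raddfB => /eqP; rewrite subr_eq0 => /eqP.
Qed.
End TensorEval.

Lemma tensor_pushU (R : comNzRingType) (V W M : lmodType R)
    (f : {linear V -> W}) v m : tensor_push M f << (v, m) >> = << (f v, m) >>.
Proof. by rewrite /= free_liftU. Qed.

Lemma tensor_eval_push (R : comNzRingType) (V W M : lmodType R) (A : zmodType)
    (f : {linear V -> W}) (b : W -> M -> A) u :
  (forall v m, b (f v) m = 0) -> tensor_eval b (tensor_push M f u) = 0.
Proof.
move=> bf0; rewrite /tensor_push /= {2}/free_lift linear_sum big1 // => p _.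
by rewrite linearZ /= free_liftU /= bf0 scaler0.
Qed.

(** The class of [<< z >>] tensor [m] is a cycle, as the scalar [r] moves across the tensor sign to
    kill [m]. The pairing [b], composed with the cover, vanishes on boundaries but takes the value
    [b z m] on this cycle. *)
Lemma Tor1_neq0 (R : comNzRingType) (F M : lmodType R) (A : zmodType) (r : R)
    (x : F) (m : M) (z : kernel (cover F)) (b : kernel (cover F) -> M -> A) :
    (forall u v m, b (u + v) m = b u m + b v m) ->
    (forall u m n, b u (m + n) = b u m + b u n) ->
    (forall a u m, b (a *: u) m = b u (a *: m)) ->
    r *: m = 0 -> val z = r *: << x >> -> b z m <> 0 ->
  ~ is_zero_group (Tor1 F M).
Proof.
move=> bDl bDr bZ rm zx bzm.
apply: (@homology_neq0 _ _ _ (tensor_map M (res_diff F 1))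
  (tensor_map M (res_diff F 0)) (\pi_(tensor (res F 1) M) << (<< z >>, m) >>)).
  apply: etrans (tensor_map_pi _ _) _.
  rewrite tensor_pushU (res_diffU (n := 0)) zx.
  apply/eqP; rewrite -(raddf0 \pi_(tensor (res F 0) M)) -Quotient.idealrBE.
  rewrite subr0 inE; apply/asboolP.
  (* The relation for [0 + 0] in the second factor is minus this generator. *)
  have m0 : bilinear_span << (<< x >> : res F 0, 0 : M) >>.
    have := spanB (span0 _ _) (spanDr (<< x >> : res F 0) (0 : M) 0).
    by rewrite addr0 subrr sub0r sub0r opprK.
  have := spanB (spanZ r (<< x >> : res F 0) m) (spanB (span0 _ _) m0).
  by rewrite rm sub0r opprK subrK.
move=> t; rewrite -[t]reprK => /(etrans (esym (tensor_map_pi _ _))).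
pose c u n := b (cover (syzygy F 1) u) n.
move=> /(@tensor_eval_pi _ _ _ A c) e; apply: bzm.
have cz : tensor_eval c << (<< z >>, m) >> = b z m.
  by rewrite tensor_evalU /c (coverU (V := syzygy F 1)).
rewrite -cz -e ?tensor_eval_push //.
(* The cover kills the differential, and [b 0 n = 0] by additivity. *)
- move=> u n; rewrite /c cover_res_diff.
  by apply: (@addrI _ (b 0 n)); rewrite -bDl !addr0.
- by move=> u v n; rewrite /c linearD bDl.
- by move=> u n p; rewrite /c bDr.
- by move=> a u n; rewrite /c linearZ bZ.
Qed.

(** * The module Z/3 and division by 3 on its first syzygy *)

Definition Z3 : Type := 'Z_3.
HB.instance Definition _ := GRing.ComNzRing.on Z3.

Definition Z3_scale (r : ZsumZ2) (x : Z3) : Z3 := r.1%:~R * x.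

Lemma Z3_scaleA a b v : Z3_scale a (Z3_scale b v) = Z3_scale (a * b) v.
Proof. by case: a b => [m a] [n b]; rewrite /Z3_scale /= rmorphM mulrA. Qed.

Lemma Z3_scale1 : left_id 1 Z3_scale.
Proof. by move=> x; rewrite /Z3_scale mul1r. Qed.

Lemma Z3_scaleDr : right_distributive Z3_scale +%R.
Proof. by move=> r x y; rewrite /Z3_scale mulrDr. Qed.

Lemma Z3_scaleDl v : {morph Z3_scale^~ v : a b / a + b}.
Proof. by move=> a b; rewrite /Z3_scale rmorphD mulrDl. Qed.

HB.instance Definition _ := GRing.Zmodule_isLmodule.Build ZsumZ2 Z3
  Z3_scaleA Z3_scale1 Z3_scaleDr Z3_scaleDl.

Lemma Z3_scaleE (r : ZsumZ2) (x : Z3) : r *: x = r.1%:~R * x.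
Proof. by []. Qed.

Lemma intr_Z3_eq0 (n : int) : (n%:~R == 0 :> Z3) = (3 %| n)%Z.
Proof. by rewrite (@dvdz_pcharf Z3 3) //; exact: (@pchar_Fp 3). Qed.

Lemma ZsumZ2_fstD (r s : ZsumZ2) : (r + s).1 = r.1 + s.1.
Proof. by []. Qed.

Lemma ZsumZ2_fstM (r s : ZsumZ2) : (r * s).1 = r.1 * s.1.
Proof. by case: r s => [? ?] []. Qed.

Lemma Z3_repr_scale1 (x : Z3) : (((x : nat)%:Z, 0) : ZsumZ2) *: (1 : Z3) = x.
Proof. by apply: etrans (mulr1 _) _; exact: (@natr_Zp 1 x). Qed.

(** Lifts the cover of Z/3 along the quotient map from the ring, by [Z3_liftP]; hence its first
    coordinate is divisible by 3 on the kernel of the cover. *)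
Definition Z3_lift : {linear {malg ZsumZ2[Z3]} -> ZsumZ2^o} :=
  free_lift (fun x : Z3 => ((x : nat)%:Z, 0) : ZsumZ2^o).

Lemma Z3_liftP (u : {malg ZsumZ2[Z3]}) : ((Z3_lift u).1)%:~R = cover Z3 u :> Z3.
Proof.
transitivity ((Z3_lift u : ZsumZ2) *: (1 : Z3)).
  exact: (esym (mulr1 _)).
rewrite /= /free_lift scaler_suml; apply: eq_bigr => x _.
rewrite -[_ *: (_ : ZsumZ2^o)]/(u@_x * _) -scalerA.
by rewrite Z3_repr_scale1.
Qed.

Definition Z3_third (u : kernel (cover Z3)) : Z3 :=
  ((Z3_lift (val u)).1 %/ 3)%Z%:~R.

(** On the kernel the integer division by 3 is exact, so it commutes with sums and multiples. *)
Lemma Z3_third_linear : linear Z3_third.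
Proof.
have d3 (u : kernel (cover Z3)) : (3 %| (Z3_lift (val u)).1)%Z.
  by rewrite -intr_Z3_eq0 Z3_liftP; exact: (valP u).
move=> a u v; rewrite /Z3_third !linearP ZsumZ2_fstD.
rewrite [X in X.1 + _]/(a * _) ZsumZ2_fstM Z3_scaleE.
have /dvdzP[m ->] := d3 u; have /dvdzP[n ->] := d3 v.
by rewrite mulrA -mulrDl !mulzK // rmorphD rmorphM.
Qed.
HB.instance Definition _ := GRing.isLinear.Build ZsumZ2 (kernel (cover Z3)) Z3
  *:%R Z3_third Z3_third_linear.

Definition three : ZsumZ2 := (3, 0).

Lemma three_mul (r : ZsumZ2) : three * r = (3 * r.1, r.2).
Proof.
case: r => m a; congr pair; apply: sumZ2_eq => i; rewrite !sumZ2E.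
rewrite mulr0 mul0r !addr0 -[RHS]mul1r.
(* What remains is [3 = 1] in ['Z_2], by computation. *)
by congr (_ * _); apply/eqP.
Qed.

Lemma three_scale_Z3 (x : Z3) : three *: x = 0.
Proof. by rewrite Z3_scaleE (_ : 3%:~R = 0) ?mul0r //; apply/eqP. Qed.

Definition three_gen : {malg ZsumZ2[Z3]} := three *: << 1 >>.

Lemma three_gen_ker : three_gen \in in_ker (cover Z3).
Proof.
by rewrite inE; apply/eqP/(etrans (linearZ _ _))/three_scale_Z3.
Qed.

Lemma Z3_third_gen : Z3_third (Kernel three_gen_ker) = 1.
Proof.
have lift_gen : Z3_lift three_gen = (3, 0).
  rewrite (etrans (linearZ _ _) (congr1 _ (free_liftU _ _))).
  exact: three_mul.
by rewrite /Z3_third [Z3_lift _]lift_gen.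
Qed.

(** * A finite free resolution of Z/3 *)

Definition Z3_proj (u : 'rV[ZsumZ2]_1) : Z3 := u 0 0 *: (1 : Z3).

Lemma Z3_proj_linear : linear Z3_proj.
Proof. by move=> a u v; rewrite /Z3_proj !mxE scalerDl scalerA. Qed.
HB.instance Definition _ := GRing.isLinear.Build ZsumZ2 'rV[ZsumZ2]_1 Z3
  *:%R Z3_proj Z3_proj_linear.

Lemma fg_free_rV (R : comNzRingType) n : @fg_free R 'rV[R]_n.
Proof. by exists n, idfun; exists id. Qed.

Lemma Z3_FP2 : @FP2 ZsumZ2 Z3.
Proof.
(* With a source of rank 0, exactness at the next term says that multiplication by 3 is
   injective. *)
exists 'rV[ZsumZ2]_0, 'rV[ZsumZ2]_1, 'rV[ZsumZ2]_1, \0,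
  (three \*: idfun), Z3_proj.
split; split; try exact: fg_free_rV.
- move=> u; split=> [/rowP/(_ 0)|[w <-]]; last by rewrite /= scaler0.
  rewrite !mxE three_mul => -[e1 e2]; exists 0.
  apply/rowP => i; rewrite ord1 !mxE.
  by case: (u 0 0) e1 e2 => m a /= e1 ->; congr pair; lia.
- move=> u; split=> [/eqP|[v <-]].
    rewrite /= /Z3_proj Z3_scaleE mulr1 intr_Z3_eq0 => /dvdzP[q uq].
    (* Only the integer coordinate is divided: 3 fixes the other one. *)
    exists (const_mx (q, (u 0 0).2)); apply/rowP => i.
    by rewrite ord1 !mxE three_mul /= mulrC -uq -surjective_pairing.
  by apply: etrans (linearZ _ _) (three_scale_Z3 _).
- move=> x; exists (const_mx ((x : nat)%:Z, 0)).
  by rewrite /= /Z3_proj mxE Z3_repr_scale1.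
Qed.

Theorem proposition33 :
  proper_subclass (@FP2_Inj ZsumZ2) (@all_modules ZsumZ2) /\
  proper_subclass (@FP2_Flat ZsumZ2) (@all_modules ZsumZ2).
Proof.
split; split=> // /(_ Z3 I Z3 Z3_FP2).
  apply: (@Ext1_neq0 _ Z3 Z3 three 1 (Kernel three_gen_ker) Z3_third
    three_scale_Z3 erefl).
  by move=> /(etrans (esym Z3_third_gen)).
(* Multiplication in Z/3 turns division by 3 into a balanced pairing, with value 1 at the generator
   and 1. *)
apply: (@Tor1_neq0 _ Z3 Z3 Z3 three 1 1 (Kernel three_gen_ker)
  (fun u m => Z3_third u * m)) => //.
- by move=> u v m; rewrite linearD mulrDl.
- by move=> u m n; rewrite mulrDr.
- by move=> a u m; rewrite linearZ /= !Z3_scaleE mulrCA mulrA.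
- exact: three_scale_Z3.
by rewrite Z3_third_gen.
Qed.
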